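(* Let $d\in\mathbb{N}$ and let $b_1,\dots,b_d\ge2$ be pairwise relatively prime integers. Then the Halton sequence $(\bm{x}_n)_{n\ge0}$ in bases $b_1,\dots,b_d$ does not have Poissonian pair correlations.
   Context: For an integer $b\ge2$, the radical inverse function $\phi_b:\mathbb{N}_0\to[0,1)$ is $\phi_b(n)=\sum_{i\ge0}n_ib^{-i-1}$, where $n=\sum_{i\ge0}n_ib^i$ with $n_i\in\{0,\dots,b-1\}$. The Halton sequence in bases $b_1,\dots,b_d$ is $\bm{x}_n=(\phi_{b_1}(n),\dots,\phi_{b_d}(n))\in[0,1)^d$, $n\ge0$. With $\|y\|$ the distance of $y\in\mathbb{R}$ to the nearest integer and $\|\bm{x}\|_\infty=\max_j\|x^{(j)}\|$, a sequence $(\bm{x}_n)_{n\ge0}$ in $[0,1)^d$ has Poissonian pair correlations if for every real $s\ge0$, $\frac1N\#\{0\le n\ne l\le N-1:\|\bm{x}_n-\bm{x}_l\|_\infty\le sN^{-1/d}\}\to(2s)^d$ as $N\to\infty$. *)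

(* Defs.v *)
From HB Require Import structures.
From mathcomp Require Import all_boot all_order all_algebra.
From mathcomp Require Import all_classical all_reals all_analysis.

Set Implicit Arguments.
Unset Strict Implicit.
Unset Printing Implicit Defensive.

Import Order.TTheory GRing.Theory Num.Theory.
Import numFieldNormedType.Exports.

Local Open Scope classical_set_scope.
Local Open Scope ring_scope.

Definition digit (b n i : nat) : nat := ((n %/ b ^ i) %% b)%N.

Lemma digit_eq0 (b n i : nat) : (1 < b)%N -> (n <= i)%N -> digit b n i = 0%N.
Proof.
move=> b1 ni; rewrite /digit divn_small ?mod0n //.
exact: leq_ltn_trans ni (ltn_expl _ b1).
Qed.

(* For [1 < b] the sum over all [i >= 0] stops before [i = n], by [digit_eq0]. *)
Definition radical_inverse (R : realType) (b n : nat) : R :=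
  \sum_(i < n) (digit b n i)%:R / b%:R ^+ i.+1.

Definition halton (R : realType) (d : nat) (b : 'I_d -> nat) (n : nat) :
  'rV[R]_d := \row_j radical_inverse R (b j) n.

Definition dist_int (R : realType) (y : R) : R :=
  inf [set `|y - m%:~R| | m in [set: int]].

(* [dist_int] is nonnegative, so the default value [0] only matters for
   [d = 0]. *)
Definition torus_norm (R : realType) (d : nat) (x : 'rV[R]_d) : R :=
  \big[Num.max/0]_(j < d) dist_int (x ord0 j).

(* Ordered pairs are counted. *)
Definition close_pairs (R : realType) (d : nat) (x : nat -> 'rV[R]_d)
    (s : R) (N : nat) : nat :=
  #|[pred p : 'I_N * 'I_N | (p.1 != p.2) &&
      (torus_norm (x p.1 - x p.2) <= s * N%:R `^ (- d%:R^-1))]|.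

Definition poissonian_pair_correlations (R : realType) (d : nat)
    (x : nat -> 'rV[R]_d) : Prop :=
  forall s : R, 0 <= s ->
    (fun N : nat => (close_pairs x s N)%:R / N%:R : R) @ \oo
      --> (2 * s) ^+ d.

(* Main.v *)
Require Import Defs.
From mathcomp Require Import all_boot all_order all_algebra.
From mathcomp Require Import all_classical all_reals all_analysis.
From mathcomp Require Import zify ring lra.

(** The distances between points of index difference [M] concentrate at a single
    value.  Write [c] for the first base and choose exponents [k], [e_j] such
    that [c^(k+1) <= b_j^(e_j) <= G c^(k+1)] for the other bases, and such that
    [M1 = prod_j b_j^(e_j)] is [1] modulo [c^(T+1)]; put [M = c^k M1].  If the
    [k]-th digit of [n] in base [c] is [0], then adding [M] to [n] increments
    this digit and fixes the other ones below [k + T + 1], so that the first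
    coordinate moves by [c^-(k+1) (1 + O(c^-T))], while the others move by at
    most [c^-(k+1)].  Among the first [N = 2 c M] points this gives [N / (2 c)]
    pairs whose distance, in units of [N^(-1/d)], lies within [O(c^-T)] of some
    [s] in [[1, 2 (G + 1)]].  As [G] does not depend on [T], this contradicts
    the uniform continuity of [(2 s)^d] on this interval. *)

Set Implicit Arguments.
Unset Strict Implicit.
Unset Printing Implicit Defensive.

Import Order.TTheory GRing.Theory Num.Theory.
Import numFieldNormedType.Exports.

Local Open Scope classical_set_scope.
Local Open Scope ring_scope.

(** * Radical inverses of congruent indices *)

Lemma radical_inverseE (R : realType) (b n K : nat) : (1 < b)%N -> (n <= K)%N ->
  radical_inverse R b n = \sum_(i < K) (digit b n i)%:R / b%:R ^+ i.+1.
Proof.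
move=> b1 nK; rewrite /radical_inverse.
rewrite -(big_mkord xpredT (fun i => (digit b n i)%:R / b%:R ^+ i.+1 : R)).
rewrite -(big_mkord xpredT (fun i => (digit b n i)%:R / b%:R ^+ i.+1 : R)).
rewrite [RHS](big_cat_nat (leq0n n) nK) /= [X in _ + X]big_nat_cond.
rewrite [X in _ + X]big1 ?addr0 // => i /andP[/andP[ni _] _].
by rewrite digit_eq0 // mul0r.
Qed.

Lemma radical_inverse_rec (R : realType) (b r q : nat) : (1 < b)%N ->
  (r < b)%N ->
  radical_inverse R b (r + b * q) = (r%:R + radical_inverse R b q) / b%:R.
Proof.
move=> b1 rb; have b0 : (0 < b)%N by apply: ltnW.
rewrite (@radical_inverseE R b _ (r + b * q).+1) // big_ord_recl /=.
rewrite (@radical_inverseE R b q (r + b * q)) //; last first.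
  by rewrite (leq_trans _ (leq_addl _ _)) // leq_pmull.
rewrite mulrDl mulr_suml; congr (_ + _).
  by rewrite /digit expn0 divn1 mulnC addnC modnMDl modn_small // expr1.
apply: eq_bigr => -[i /= _] _; rewrite /digit /bump /= add1n expnS divnMA.
have -> : ((r + b * q) %/ b = q)%N.
  by rewrite addnC mulnC divnMDl // divn_small // addn0.
by rewrite (exprS _ i.+1) invfM mulrA mulrAC.
Qed.

Lemma radical_inverse_ge0 (R : realType) (b n : nat) :
  0 <= radical_inverse R b n.
Proof. by apply: sumr_ge0 => i _; rewrite divr_ge0 ?exprn_ge0. Qed.

Lemma radical_inverse_le1 (R : realType) (b n : nat) : (1 < b)%N ->
  radical_inverse R b n <= 1.
Proof.
move=> b1; have b0 : (0 < b)%N by apply: ltnW.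
elim/ltn_ind: n => -[_|n IHn]; first by rewrite /radical_inverse big_ord0.
rewrite (divn_eq n.+1 b) addnC mulnC radical_inverse_rec ?ltn_mod //.
have bR : 0 < b%:R :> R by rewrite ltr0n.
rewrite ler_pdivrMr // mul1r.
have : (n.+1 %% b)%:R + 1 <= b%:R :> R by rewrite natr1 ler_nat ltn_mod.
have := IHn _ (ltn_Pdiv b1 (ltn0Sn n)); lra.
Qed.

Lemma radical_inverse_dist_le1 (R : realType) (b n l : nat) : (1 < b)%N ->
  `|radical_inverse R b n - radical_inverse R b l| <= 1.
Proof.
move=> b1; have := radical_inverse_le1 R n b1; have := radical_inverse_le1 R l b1.
have := radical_inverse_ge0 R b n; have := radical_inverse_ge0 R b l.
by rewrite ler_norml => *; lra.
Qed.

(** The common low digits, those of [r], cancel in the difference, and the higher ones are pushed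
    [k] places further. *)
Lemma radical_inverse_shift (R : realType) (b k r q q' : nat) : (1 < b)%N ->
  (r < b ^ k)%N ->
  radical_inverse R b (r + b ^ k * q) - radical_inverse R b (r + b ^ k * q') =
  (radical_inverse R b q - radical_inverse R b q') / b%:R ^+ k.
Proof.
move=> b1; have b0 : (0 < b)%N by apply: ltnW.
elim: k r => [|k IHk] r.
  by rewrite expn0 ltnS leqn0 => /eqP ->; rewrite !mul1n !add0n expr0 divr1.
rewrite expnS => rk.
have E p : (r + b * b ^ k * p = r %% b + b * (r %/ b + b ^ k * p))%N.
  by rewrite mulnDr mulnA addnA [(b * (r %/ b))%N]mulnC [(r %% b + _)%N]addnC -divn_eq.
rewrite !E !radical_inverse_rec ?ltn_mod // -mulrBl opprD addrACA subrr add0r.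
by rewrite IHk ?ltn_divLR 1?mulnC // exprS invfM mulrA mulrAC.
Qed.

(** Congruent indices share their [k] lowest digits, so both values lie in one interval of length
    [b ^- k]. *)
Lemma radical_inverse_eqmod (R : realType) (b k n l : nat) : (1 < b)%N ->
  n = l %[mod b ^ k] ->
  `|radical_inverse R b n - radical_inverse R b l| <= (b%:R ^+ k)^-1.
Proof.
move=> b1 nl; have b0 : (0 < b)%N by apply: ltnW.
rewrite (divn_eq n (b ^ k)) (divn_eq l (b ^ k)) nl.
rewrite ![(_ * b ^ k)%N]mulnC ![(b ^ k * _ + _)%N]addnC.
rewrite radical_inverse_shift ?ltn_mod ?expn_gt0 ?b0 // normrM.
have bk : 0 <= (b%:R ^+ k)^-1 :> R by rewrite invr_ge0 exprn_ge0.
by rewrite (ger0_norm bk) ler_piMl // radical_inverse_dist_le1.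
Qed.

(** * Balanced powers of the bases *)

(* The exponents are differences of two values of [trunc_log (b j) X], so that
   the pigeonhole principle on the residues gives the congruence without
   destroying the balance of the powers. *)
Lemma balanced_exponents (d : nat) (b : 'I_d -> nat) (j0 : 'I_d) :
  (forall j, 2 <= b j)%N -> (forall i j, i != j -> coprime (b i) (b j)) ->
  exists G : nat, forall T K : nat, exists (k : nat) (e : 'I_d -> nat),
  [/\ (K <= k)%N,
      forall j, j != j0 ->
        (b j0 ^ k.+1 <= b j ^ e j <= G * b j0 ^ k.+1)%N
    & \prod_(j < d | j != j0) b j ^ e j = 1 %[mod b j0 ^ T]]%N.
Proof.
move=> hb hcop.
pose B := (\sum_(j < d) b j)%N.
have bB j : (b j <= B)%N by rewrite /B (bigD1 j) //= leq_addr.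
set c := b j0; have c1 : (1 < c)%N by exact: hb.
have c0 : (0 < c)%N by apply: ltnW.
(* The factor [B] pays for rounding in [trunc_log], and [c ^ B] for the [B] subtracted from the
   exponent of [c] below. *)
exists (B * c ^ B)%N => T K.
pose L := (K + B).+1.
pose a i j := trunc_log (b j) (c ^ (L * i)).
pose y i := (\prod_(j < d | j != j0) b j ^ a i j)%N.
have cT : (0 < c ^ T)%N by rewrite expn_gt0 c0.
have [i [i' [ii' yE]]] : exists i i', (i < i')%N /\ y i = y i' %[mod c ^ T].
  pose f (i : 'I_(c ^ T).+1) : 'I_(c ^ T) := Ordinal (ltn_pmod (y i) cT).
  have /injectivePn[i [i' ii' fE]] : ~~ injectiveb f.
    apply/negP => /injectiveP /leq_card.
    by rewrite !card_ord ltnn.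
  have {}fE : y i = y i' %[mod c ^ T] by have := congr1 val fE.
  case: (ltngtP i i') => [h|h|h]; first by exists i, i'.
  - by exists i', i.
  - by move/eqP: ii'; case; apply: val_inj.
have aP m j : (b j ^ a m j <= c ^ (L * m) < b j ^ (a m j).+1)%N.
  by apply: trunc_log_bounds; rewrite ?expn_gt0 ?c0.
have aM j : (a i j <= a i' j)%N.
  by apply: leq_trunc_log; rewrite leq_pexp2l // leq_mul2l (ltnW ii') orbT.
have LE : ((L * (i' - i) - B).-1.+1 + B = L * (i' - i))%N.
  have : (L * 1 <= L * (i' - i))%N by rewrite leq_mul2l subn_gt0 ii' orbT.
  rewrite /L; lia.
(* Rounding may cost [b j ^ e j] a factor [b j] against [c ^ (L * (i' - i))]; lowering the exponent
   by [B] absorbs it, as [b j <= c ^ B]. *)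
exists (L * (i' - i) - B).-1, (fun j => a i' j - a i j)%N; split.
- have : (L * 1 <= L * (i' - i))%N by rewrite leq_mul2l subn_gt0 ii' orbT.
  rewrite /L; lia.
- move=> j _; set k := (_.-1).
  have bj0 : (0 < b j)%N by apply: ltnW.
  have eE : (b j ^ a i' j = b j ^ (a i' j - a i j) * b j ^ a i j)%N.
    by rewrite -expnD subnK.
  have cE : (c ^ (L * i') = c ^ k.+1 * c ^ B * c ^ (L * i))%N.
    by rewrite -!expnD LE -mulnDr subnK // ltnW.
  have BcB : (b j <= c ^ B)%N.
    by rewrite (leq_trans (bB j)) // ltnW // ltn_expl.
  have ci0 : (0 < c ^ (L * i))%N by rewrite expn_gt0 c0.
  have bi0 : (0 < b j ^ a i j)%N by rewrite expn_gt0 bj0.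
  have /andP[l1 u1] := aP i j; have /andP[l2 u2] := aP i' j.
  apply/andP; split.
    rewrite -(leq_pmul2r (_ : 0 < b j * c ^ (L * i))%N) ?muln_gt0 ?bj0 //.
    apply: (@leq_trans (c ^ (L * i'))).
      by rewrite cE -mulnA leq_mul2l leq_mul2r BcB !orbT.
    apply: (leq_trans (ltnW u2)); rewrite expnS eE mulnCA.
    by rewrite !leq_mul2l l1 !orbT.
  rewrite -(leq_pmul2r bi0) -eE (leq_trans l2) // cE.
  apply: (@leq_trans (c ^ k.+1 * c ^ B * (B * b j ^ a i j))).
    rewrite leq_mul2l (leq_trans (ltnW u1)) ?orbT //.
    by rewrite expnS leq_mul2r bB orbT.
  by rewrite mulnA (mulnC (_ * _)%N B) [(c ^ k.+1 * _)%N]mulnC mulnA.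
- rewrite -/c.
  set x := (\prod_(_ < d | _) _)%N.
  have x0 : (0 < x)%N by apply: prodn_gt0 => j; rewrite expn_gt0 ltnW.
  have yx : (y i' = x * y i)%N.
    by rewrite /y -big_split /=; apply: eq_bigr => j _; rewrite -expnD subnK.
  apply/eqP; rewrite eqn_mod_dvd //.
  (* Coprimality allows [y i] to be cancelled from [x * y i = y i] modulo [c ^ T]. *)
  have cop : coprime (c ^ T) (y i).
    rewrite coprime_sym /y; elim/big_ind: _ => [|u v hu hv|j jj0].
    - by rewrite coprime1n.
    - by rewrite coprimeMl hu hv.
    - by rewrite coprimeXl // coprimeXr // hcop.
  rewrite -(Gauss_dvdl _ cop) mulnBl mul1n -yx -eqn_mod_dvd //.
    by apply/eqP.
  by rewrite yx leq_pmull.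
Qed.

(** * Torus distance and concentration of pair distances *)

Lemma dist_int_le (R : realType) (y : R) : dist_int y <= `|y|.
Proof.
apply: ge_inf; first by exists 0 => _ [m _ <-].
by exists 0 => //; rewrite subr0.
Qed.

Lemma dist_int_small (R : realType) (y : R) : `|y| <= 2^-1 ->
  dist_int y = `|y|.
Proof.
move=> y2; apply/eqP; rewrite eq_le dist_int_le /=.
apply: lb_le_inf; first by exists `|y|, 0 => //; rewrite subr0.
move=> _ [m _ <-]; have [->|m0] := eqVneq m 0; first by rewrite subr0.
have m1 : 1 <= `|m%:~R| :> R by rewrite -intr_norm ler1z -gtz0_ge1 normr_gt0.
have := lerB_dist m%:~R y; rewrite distrC; lra.
Qed.

(** The pairs [(f i, g i)] are distinct, counted at radius [t] and not yet at radius [s]. *)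
Lemma close_pairs_shell (R : realType) (d : nat) (x : nat -> 'rV[R]_d)
    (s t : R) (N : nat) (I : finType) (f g : I -> 'I_N) :
  injective f -> (forall i, f i != g i) -> s <= t ->
  (forall i, s * N%:R `^ (- d%:R^-1) < torus_norm (x (f i) - x (g i))
    <= t * N%:R `^ (- d%:R^-1)) ->
  (close_pairs x s N + #|I| <= close_pairs x t N)%N.
Proof.
move=> f_inj fg st fgst; rewrite /close_pairs.
set P := (X in (#|X| + _ <= _)%N); set Q := (X in (_ <= #|X|)%N).
pose h i := (f i, g i).
have h_inj : injective h by move=> i j [/f_inj].
rewrite -(card_codom h_inj) -cardUI.
rewrite [X in (_ + X)%N]eq_card0 ?addn0 => [|p].
  apply: subset_leq_card; apply/fintype.subsetP => p; rewrite !inE.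
  case/orP => [/andP[-> ps] /=|/codomP[i ->] /=].
    by rewrite (le_trans ps) // ler_wpM2r ?powR_ge0.
  by rewrite fg; case/andP: (fgst i).
rewrite !inE; apply/negP => /andP[/andP[_ ps] /codomP[i pE]].
by move: ps; rewrite pE leNgt /=; case/andP: (fgst i) => ->.
Qed.

(** A Lipschitz bound for the power; as [1 <= V], the exponent [d] of [V] can replace [d.-1], which
    keeps the induction simple. *)
Lemma exprD_sub_le (R : realFieldType) (u h V : R) (d : nat) :
  0 <= u -> 0 <= h -> 1 <= V -> u + h <= V ->
  (u + h) ^+ d - u ^+ d <= h * d%:R * V ^+ d.
Proof.
move=> u0 h0 V1 uhV; have V0 : 0 <= V by lra.
elim: d => [|d IHd]; first by rewrite !expr0 mulr0 mul0r subrr.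
have -> : (u + h) ^+ d.+1 - u ^+ d.+1 =
    (u + h) * ((u + h) ^+ d - u ^+ d) + h * u ^+ d by rewrite !exprS; ring.
have -> : h * d.+1%:R * V ^+ d.+1 =
    V * (h * d%:R * V ^+ d) + h * V ^+ d.+1 by rewrite -natr1 exprS; ring.
apply: lerD.
  apply: (@le_trans _ _ (V * ((u + h) ^+ d - u ^+ d))).
    by apply: ler_wpM2r => //; rewrite subr_ge0 lerXn2r ?nnegrE //; lra.
  by apply: ler_wpM2l.
apply: ler_wpM2l => //; apply: (@le_trans _ _ (V ^+ d)).
  by rewrite lerXn2r ?nnegrE //; lra.
by rewrite exprS ler_peMl // exprn_ge0.
Qed.

(** A thin shell around [s] carries at least [c * N] pairs, whereas the increment of the limit
    across the shell is at most [c / 4]. *)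
Lemma concentration_not_poissonian (R : realType) (d : nat)
    (x : nat -> 'rV[R]_d) (c S : R) :
  0 < c -> 1 <= S ->
  (forall (e : R) (N0 : nat), 0 < e -> exists N : nat,
    [/\ (0 < N)%N, (N0 <= N)%N &
    exists (s : R) (I : finType) (f g : I -> 'I_N),
    [/\ 1 <= s <= S, injective f /\ (forall i, f i != g i),
        c * N%:R <= #|I|%:R &
        forall i, `|torus_norm (x (f i) - x (g i)) - s * N%:R `^ (- d%:R^-1)|
          <= e * N%:R `^ (- d%:R^-1)]]) ->
  ~ poissonian_pair_correlations x.
Proof.
move=> c0 S1 conc ppc.
pose V := 2 * S + 4.
have V1 : 1 <= V by rewrite /V; lra.
have V0 : 0 < V ^+ d by apply: exprn_gt0; lra.
(* Chosen so that [4 * w * d.+1%:R * V ^+ d = c / 4], the bound for the increment over two grid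
   steps. *)
pose w := c / (16 * d.+1%:R * V ^+ d).
have d0 : 0 < d.+1%:R :> R by rewrite ltr0n.
have w0 : 0 < w by rewrite divr_gt0 // !mulr_gt0.
(* The limits hold uniformly on the finite grid of multiples of [h], two steps
   of which enclose the shell of concentration. *)
pose h := Num.min w 2^-1.
have h0 : 0 < h by rewrite lt_min w0 /=; lra.
have h1 : h <= 2^-1 by rewrite ge_min lexx orbT.
have hw : h <= w by rewrite ge_min lexx.
have step u : 0 <= u -> u <= S -> (2 * (u + 2 * h)) ^+ d - (2 * u) ^+ d <= c / 4.
  move=> u0 uS; rewrite mulrDr.
  apply: le_trans (@exprD_sub_le _ _ _ V d _ _ V1 _) _; [lra|lra|rewrite /V; lra|].
  apply: (@le_trans _ _ (2 * (2 * w) * d.+1%:R * V ^+ d)).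
    apply: ler_wpM2r; first exact: ltW.
    apply: ler_pM => //; [lra| |by rewrite ler_nat].
    lra.
  rewrite /w le_eqVlt; apply/orP; left; apply/eqP; field.
  by rewrite gt_eqF //= nat1r gt_eqF.
pose J := (Num.truncn (S / h)).+3.
have cvgJ : \forall N \near \oo, forall i : 'I_J,
    `|(2 * (h * i%:R)) ^+ d - (close_pairs x (h * i%:R) N)%:R / N%:R| < c / 8.
  apply: filter_forall => i.
  have /ppc/cvgrPdist_lt : 0 <= h * i%:R by rewrite mulr_ge0 // ltW.
  by apply; lra.
case: cvgJ => N0 _ /= cvgJ.
have [N [Npos N0N [s [I [f [g [/andP[s1 sS] [f_inj fg] cI conc_s]]]]]]] :=
  conc (h / 4) N0 ltac:(lra).
have NR : 0 < N%:R :> R by rewrite ltr0n.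
set nu := N%:R `^ _ in conc_s.
have nu0 : 0 < nu by apply: powR_gt0.
(* The offset [h / 2] leaves a margin of at least [h / 4] on both sides of [s] inside the shell from
   [h * i] to [h * (i + 2)]. *)
pose i := Num.truncn ((s - h / 2) / h).
have ih0 : 0 <= (s - h / 2) / h by rewrite divr_ge0 //; lra.
have /andP[il iu] : i%:R * h <= s - h / 2 < (i%:R + 1) * h.
  have := truncn_itv ih0; rewrite -/i.
  by rewrite ler_pdivlMr // ltr_pdivrMr // natr1.
have iJ : (i.+2 < J)%N.
  rewrite /J !ltnS; apply: le_truncn; rewrite ler_pM2r ?invr_gt0 //; lra.
have iJ' : (i < J)%N := ltnW (ltnW iJ).
have := cvgJ N N0N (Ordinal iJ'); have := cvgJ N N0N (Ordinal iJ) => /=.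
have -> : h * i.+2%:R = h * i%:R + 2 * h by rewrite -addn2 natrD; ring.
have i0 : 0 <= h * i%:R by rewrite mulr_ge0 // ltW.
rewrite !ltr_norml => /andP[lo2 hi2] /andP[lo1 hi1].
have shell : (close_pairs x (h * i%:R) N + #|I| <=
    close_pairs x (h * i%:R + 2 * h) N)%N.
  apply: (close_pairs_shell f_inj fg); first by lra.
  move=> a; have := conc_s a; rewrite -/nu ler_distl => /andP[la ua].
  have p1 : h * i%:R * nu < (s - h / 4) * nu by rewrite ltr_pM2r //; lra.
  have p2 : (s + h / 4) * nu <= (h * i%:R + 2 * h) * nu by rewrite ler_pM2r //; lra.
  apply/andP; split; lra.
have := step (h * i%:R) i0 ltac:(lra).
(* Dividing by [N] gives [c <= c / 4 + 2 * (c / 8)], a contradiction. *)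
move: shell; rewrite -(ler_nat R) natrD -(ler_pM2r (_ : 0 < N%:R^-1)) ?invr_gt0 //.
move: cI; rewrite -ler_pdivlMr // mulrDl.
lra.
Qed.

(** Coordinate [j0] bounds the maximum from below, and no other one exceeds [rho]; below [1 / 2]
    reduction modulo 1 changes nothing. *)
Lemma torus_norm_approx (R : realType) (d : nat) (x : 'rV[R]_d) (j0 : 'I_d)
    (rho eta : R) :
  0 <= eta -> rho + eta <= 2^-1 -> 0 <= rho ->
  `| `|x ord0 j0| - rho| <= eta ->
  (forall j, j != j0 -> `|x ord0 j| <= rho) ->
  `|torus_norm x - rho| <= eta.
Proof.
move=> eta0 small rho0; rewrite ler_distl => /andP[lo hi] others.
rewrite ler_distl /torus_norm; apply/andP; split.
  apply: (le_trans lo); rewrite -dist_int_small; last by lra.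
  exact: (le_bigmax _ (fun j => dist_int (x ord0 j))).
apply: bigmax_le => [|j _]; first by lra.
apply: (le_trans (dist_int_le _)).
by have [->|/others] := eqVneq j j0; [|lra].
Qed.

(** * Return distances of the Halton sequence *)

Lemma halton_return (R : realType) (d : nat) (b : 'I_d -> nat) (j0 : 'I_d)
    (k T M1 r i : nat) :
  (forall j, 2 <= b j)%N -> (0 < k)%N -> (r < b j0 ^ k)%N ->
  M1 = 1 %[mod b j0 ^ T.+1] ->
  (forall j, j != j0 -> exists2 e, (b j ^ e %| M1)%N
    & (b j0 ^ k.+1 <= b j ^ e)%N) ->
  `|torus_norm (halton R b (r + b j0 ^ k * (b j0 * i)) -
      halton R b (r + b j0 ^ k * (b j0 * i) + b j0 ^ k * M1))
    - (b j0 ^ k.+1)%:R^-1| <= (b j0 ^ k.+1)%:R^-1 / (b j0 ^ T)%:R.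
Proof.
move=> hb k0 rk M1E others; set c := b j0 in rk M1E others *.
have c1 : (1 < c)%N by exact: hb.
have c0 : (0 < c)%N by apply: ltnW.
have P0 : 0 < (c ^ k.+1)%:R :> R by rewrite ltr0n expn_gt0 c0.
have cT0 : 0 < (c ^ T)%:R :> R by rewrite ltr0n expn_gt0 c0.
(* Ensures [rho + eta <= 1 / 2]; this is where [0 < k] enters. *)
have P4 : 4 <= (c ^ k.+1)%:R :> R.
  rewrite ler_nat (@leq_trans (c ^ 2)) //.
    by rewrite -[4%N]/(2 ^ 2)%N leq_exp2r.
  by rewrite leq_pexp2l.
have rho4 : (c ^ k.+1)%:R^-1 <= 4^-1 :> R by rewrite lef_pV2 ?posrE.
have rho0 : 0 < (c ^ k.+1)%:R^-1 :> R by rewrite invr_gt0.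
have cT1 : (c ^ T)%:R^-1 <= 1 :> R by rewrite invf_le1 // ler1n -(ltr0n R).
have cTV0 : 0 < (c ^ T)%:R^-1 :> R by rewrite invr_gt0.
apply: (@torus_norm_approx _ _ _ j0).
- by rewrite ltW // mulr_gt0.
- have : (c ^ k.+1)%:R^-1 / (c ^ T)%:R <= (c ^ k.+1)%:R^-1 :> R.
    by rewrite ger_pMr.
  lra.
- exact: ltW.
- rewrite !mxE -/c -addnA -mulnDr radical_inverse_shift //.
  (* The digit at position [k] passes from 0 to 1, and the next [T] digits, those of [i] modulo
     [c ^ T], are kept. *)
  have -> : (c * i + M1 = 1 + c * (i + c ^ T * (M1 %/ c ^ T.+1)))%N.
    rewrite [in LHS](divn_eq M1 (c ^ T.+1)) M1E modn_small.
      by rewrite expnS; nia.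
    by rewrite -(expn0 c) ltn_exp2l.
  rewrite -[(c * i)%N]add0n !radical_inverse_rec // add0r.
  set u := radical_inverse R c i; set v := radical_inverse R c (i + _).
  have uv : `|u - v| <= (c ^ T)%:R^-1.
    rewrite natrX; apply: radical_inverse_eqmod => //.
    by rewrite addnC mulnC modnMDl.
  have cR : c%:R != 0 :> R by rewrite pnatr_eq0 -lt0n.
  have -> : (u / c%:R - (1%:R + v) / c%:R) / c%:R ^+ k =
      (u - v - 1) * (c ^ k.+1)%:R^-1.
    by rewrite natrX exprS; field; rewrite expf_neq0 // cR.
  rewrite normrM (gtr0_norm rho0) ler0_norm; last first.
    by move: uv; rewrite ler_norml => /andP[_]; lra.
  have -> : - (u - v - 1) * (c ^ k.+1)%:R^-1 - (c ^ k.+1)%:R^-1 =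
      - ((u - v) * (c ^ k.+1)%:R^-1) by ring.
  rewrite normrN normrM (gtr0_norm rho0) mulrC.
  by apply: ler_wpM2l => //; apply: ltW.
- move=> j /others [e /dvdnP[m M1m] Pe]; rewrite !mxE.
  apply: (@le_trans _ _ ((b j)%:R ^+ e)^-1).
    apply: radical_inverse_eqmod; first exact: hb.
    by rewrite M1m [(_ * (m * _))%N]mulnA -[in RHS]modnDmr modnMl addn0.
  by rewrite -natrX lef_pV2 ?posrE ?ltr0n ?expn_gt0 ?c0 ?(ltnW (hb j)) // ler_nat.
Qed.

(** * Choice of parameters and count of the pairs *)

Theorem theorem2 (R : realType) (d : nat) (b : 'I_d -> nat)
    (hd : (0 < d)%N)
    (hb : forall j : 'I_d, (2 <= b j)%N)
    (hcop : forall i j : 'I_d, i != j -> coprime (b i) (b j)) :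
  ~ poissonian_pair_correlations (halton R b).
Proof.
pose j0 := Ordinal hd; set c := b j0.
have c1 : (1 < c)%N by exact: hb.
have c0 : (0 < c)%N by apply: ltnW.
have [G bal] := balanced_exponents j0 hb hcop.
pose S : R := (2 * G.+1)%:R.
have S1 : 1 <= S by rewrite ler1n.
have cR : 0 < c%:R :> R by rewrite ltr0n.
apply: (@concentration_not_poissonian _ _ _ (2 * c%:R)^-1 S) => //.
  by rewrite invr_gt0 mulr_gt0.
move=> eps N0 eps0.
(* [S] depends on [G] only, so [T] may be chosen after it; the relative error [c ^- T] then costs at
   most [S / c ^ T <= eps]. *)
pose T := Num.bound (S / eps).
have Teps : S / (c ^ T)%:R <= eps.
  have TS : S / eps < T%:R by apply: archi_boundP; rewrite divr_ge0 // ltW //; lra.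
  rewrite ler_pdivrMr ?ltr0n ?expn_gt0 ?c0 // mulrC -ler_pdivrMr //.
  by rewrite (le_trans (ltW TS)) // ler_nat ltnW // ltn_expl.
have [k [e [N0k eP M1E]]] := bal T.+1 N0.+1.
rewrite -/c in eP M1E; set M1 := (\prod_(_ < d | _) _)%N in M1E.
have M10 : (0 < M1)%N by apply: prodn_gt0 => j; rewrite expn_gt0 ltnW.
set P := (c ^ k.+1)%N in eP.
have P0 : (0 < P)%N by rewrite expn_gt0 c0.
have ck0 : (0 < c ^ k)%N by rewrite expn_gt0 c0.
(* The product [P * M1] has [d] factors between [P] and [G.+1 * P], hence [N] is comparable to
   [P ^ d] uniformly in [T]. *)
pose N := (2 * (P * M1))%N.
have N_gt0 : (0 < N)%N by rewrite !muln_gt0 P0.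
have prodP (A : nat) : (A ^ d = A * \prod_(j < d | j != j0) A)%N.
  by rewrite -[in LHS](card_ord d) -prod_nat_const (bigD1 j0).
have Nlo : (P ^ d <= N)%N.
  rewrite prodP /N mulnCA leq_mul2l (leq_trans _ (leq_pmull _ _)) ?orbT //.
  by apply: leq_prod => j /eP /andP[].
have Nhi : (N <= (2 * G.+1 * P) ^ d)%N.
  rewrite prodP /N mulnA leq_mul //; first by rewrite leq_mul2r leq_pmulr ?orbT.
  apply: leq_prod => j /eP /andP[_ /leq_trans]; apply.
  by rewrite leq_mul2r; apply/orP; right; lia.
have NR : 0 < N%:R :> R by rewrite ltr0n.
exists N; split=> //.
  apply: (@leq_trans P); last by rewrite /N mulnCA leq_pmulr // muln_gt0.
  by rewrite (leq_trans (ltnW N0k)) // (leq_trans (leqnSn k)) // ltnW // ltn_expl.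
set nu := N%:R `^ _.
have nu0 : 0 < nu by apply: powR_gt0.
have nud : nu ^+ d = N%:R^-1.
  rewrite -powR_mulrn ?(ltW nu0) // -powRrM mulNr mulVf ?pnatr_eq0 -?lt0n //.
  by rewrite powR_inv1 // ltW.
have PR : 0 < P%:R :> R by rewrite ltr0n.
(* The displacement [1 / P] in units of [N ^ (- 1 / d)]. *)
pose s := P%:R^-1 / nu.
have snu : s * nu = P%:R^-1 by rewrite divfK // gt_eqF.
have s0 : 0 <= s by rewrite divr_ge0 ?invr_ge0 // ltW.
have sd : s ^+ d = N%:R / P%:R ^+ d.
  by rewrite exprMn !exprVn nud invrK mulrC.
have sS : s <= S.
  rewrite -(ler_pXn2r hd) ?nnegrE //.
  by rewrite sd ler_pdivrMr ?exprn_gt0 // -exprMn -natrM -natrX ler_nat.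
have fN (p : 'I_(c ^ k) * 'I_M1) :
    (p.1 + c ^ k * (c * p.2) + c ^ k * M1 < N)%N.
  case: p => -[r rk] [i iM] /=; rewrite /N /P expnS.
  have : (c ^ k * (c * i.+1) <= c ^ k * (c * M1))%N by rewrite !leq_mul2l iM !orbT.
  have : (c ^ k * M1 <= c ^ k * (c * M1))%N.
    by rewrite leq_mul2l leq_pmull ?orbT.
  have : (c ^ k <= c ^ k * c)%N by rewrite leq_pmulr.
  nia.
(* The pair [(r, i)] encodes the index [r + c ^ k.+1 * i] below [P * M1], whose digit at position
   [k] is 0; there are [c ^ k * M1 = N / (2 * c)] of them. *)
exists s, ('I_(c ^ k) * 'I_M1)%type,
  (fun p => Ordinal (leq_ltn_trans (leq_addr _ _) (fN p))),
  (fun p => Ordinal (fN p)); split.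
- apply/andP; split => //.
  rewrite -(ler_pXn2r hd) ?nnegrE // expr1n sd ler_pdivlMr ?exprn_gt0 //.
  by rewrite mul1r -natrX ler_nat.
- split.
    move=> [r i] [r' i'] /(congr1 val) /= E.
    have /eqP rr : (r == r' :> nat).
      have := congr1 (fun m => m %% c ^ k)%N E.
      by rewrite ![(c ^ k * _)%N]mulnC ![(_ + _ * c ^ k)%N]addnC !modnMDl !modn_small // => ->.
    move: E; rewrite rr => /eqP; rewrite eqn_add2l !eqn_pmul2l // => /eqP ii.
    by congr (_, _); apply: val_inj.
  move=> p; rewrite -val_eqE /= -[X in X != _]addn0 eqn_add2l eq_sym.
  by rewrite -lt0n muln_gt0 ck0.
- rewrite card_prod !card_ord /N /P expnS !natrM.
  by rewrite le_eqVlt; apply/orP; left; apply/eqP; field; rewrite gt_eqF.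
- move=> [[r rk] i] /=; rewrite snu.
  apply: le_trans (@halton_return R d b j0 k T M1 r i hb _ rk M1E _) _.
  + exact: leq_trans N0k.
  + move=> j jj0; exists (e j); last by case/andP: (eP _ jj0).
    by rewrite /M1 (bigD1 j) //= dvdn_mulr.
  + rewrite -/c -/P -snu mulrAC ler_wpM2r ?(ltW nu0) //.
    apply: le_trans Teps; rewrite ler_pM2r ?invr_gt0 ?ltr0n ?expn_gt0 ?c0 //.
Qed.
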